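(* Let $\pi\in S(\mathbb{Z}_{23})$. Then $t([\pi])=21$ if and only if there are $c,d\in\mathbb{Z}_{23}$ and $a,b\in\mathbb{Z}_{23}^\times$ with $\pi(x)=[a,b](x+c)+d$ for all $x$, where either $(a,b)\in\{(5,7),(7,5),(10,14),(14,10),(11,15),(15,11),(20,21),(21,20)\}$, or $a=b$ and $a\in\{5,7,10,11,14,15,17,19,20,21\}$.
   Context: $S(\mathbb{Z}_n)$ is the set of bijections $\mathbb{Z}_n\to\mathbb{Z}_n$. For $\pi\in S(\mathbb{Z}_n)$, $\mathrm{cyc}(\pi)$ is the number of cycles (including fixed points) of $\pi$, $t(\pi)=n-\mathrm{cyc}(\pi)$, $[\pi]=\{x\mapsto \pi(x+b): b\in\mathbb{Z}_n\}$ and $t([\pi])=\min_{\sigma\in[\pi]}t(\sigma)$. For a prime $p$ and $a,b\in\mathbb{Z}_p^\times$, $[a,b]\in S(\mathbb{Z}_p)$ is defined by $[a,b](x)=ax$ if $x=y^2$ for some $y\in\mathbb{Z}_p$ (including $x=0$), and $[a,b](x)=bx$ otherwise. *)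

(* Defs.v *)
From mathcomp Require Import all_boot all_order all_algebra all_fingroup.
Set Implicit Arguments. Unset Strict Implicit. Unset Printing Implicit Defensive.
Import GRing.Theory.
Local Open Scope ring_scope.

Definition addperm (n : nat) (b : 'Z_n) : {perm 'Z_n} :=
  perm (addIr b).

(* cyc(pi): number of cycles, including fixed points *)
Definition cyc (n : nat) (pi : {perm 'Z_n}) : nat := #|porbits pi|.

(* t(pi) = n - cyc(pi); here #|'Z_n| = n for n >= 2 *)
Definition tperm (n : nat) (pi : {perm 'Z_n}) : nat := (#|'Z_n| - cyc pi)%N.

(* the element x |-> pi (x + b) of [pi]; note (s * t) x = t (s x) *)
Definition shiftp (n : nat) (pi : {perm 'Z_n}) (b : 'Z_n) : {perm 'Z_n} :=
  (addperm b * pi)%g.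

Definition tclass (n : nat) (pi : {perm 'Z_n}) : nat :=
  tperm (shiftp pi [arg min_(b < (0 : 'Z_n)) tperm (shiftp pi b)]).

Definition is_sq (p : nat) (x : 'Z_p) : bool := [exists y : 'Z_p, y * y == x].

Definition abmap (p : nat) (a b : 'Z_p) (x : 'Z_p) : 'Z_p :=
  if is_sq x then a * x else b * x.

Lemma shiftp_val (n : nat) (pi : {perm 'Z_n}) b x : shiftp pi b x = pi (x + b).
Proof. by rewrite /shiftp permM /addperm permE. Qed.

(* Main.v *)
(** Each of the 23 shifts x |-> pi (x + b) has at most two cycles, hence at most
    one fixed point, and every x is fixed by exactly one shift; so every shift is
    a fixed point together with a 22-cycle.  Equivalently pi is injective, so is
    pi x - x, and no map v |-> pi v + b has a cycle of length 2, ..., 21 (the case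
    of length 2 says that pi x + x is injective).  These conditions are invariant
    under pi |-> s^-1 (pi (s x + t) - w) and under inversion.

    The permutations satisfying them are enumerated by exhaustive search over
    partial permutations, branching on a row, a column, a difference y - x or a
    sum x + y.  Once the triple of cells (0,0), (1,r), (u,v) has been shown to
    occur only in the listed permutations, all its images under the symmetries
    are forbidden in later searches.  After the thirty triples of [pattern_list],
    the search from the single cell (0,0) is short.

    The search itself is not verified: it produces trees that only name the line
    branched on and the reason excluding each of its cells, and [refutes] checks
    such a tree.  Residues form a 23-constructor type and partial maps are
    23-field records so that lookups and arithmetic cost a few reductions. *)

Require Import Defs.
From HB Require Import structures.
From mathcomp Require Import all_boot all_order all_algebra all_fingroup.
From mathcomp Require Import ring.
Set Implicit Arguments. Unset Strict Implicit. Unset Printing Implicit Defensive.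
Import GRing.Theory.

(** * Residues modulo 23 and vectors indexed by them *)

Inductive res : Set :=
  | r0 | r1 | r2 | r3 | r4 | r5 | r6 | r7 | r8 | r9 | r10 | r11 | r12 | r13
  | r14 | r15 | r16 | r17 | r18 | r19 | r20 | r21 | r22.

Definition residues : seq res :=
  [:: r0; r1; r2; r3; r4; r5; r6; r7; r8; r9; r10; r11; r12; r13; r14; r15;
  r16; r17; r18; r19; r20; r21; r22].

(** Expanding [f] into 23 branches lets [Eval cbv] turn the operations below into literal lookup
    tables. *)
Definition tabulate A (f : res -> A) (i : res) : A :=
  match i with
  | r0 => f r0 | r1 => f r1 | r2 => f r2 | r3 => f r3 | r4 => f r4
  | r5 => f r5 | r6 => f r6 | r7 => f r7 | r8 => f r8 | r9 => f r9
  | r10 => f r10 | r11 => f r11 | r12 => f r12 | r13 => f r13 | r14 => f r14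
  | r15 => f r15 | r16 => f r16 | r17 => f r17 | r18 => f r18 | r19 => f r19
  | r20 => f r20 | r21 => f r21 | r22 => f r22
  end.

Definition res_nat (i : res) : nat :=
  match i with
  | r0 => 0 | r1 => 1 | r2 => 2 | r3 => 3 | r4 => 4 | r5 => 5 | r6 => 6
  | r7 => 7 | r8 => 8 | r9 => 9 | r10 => 10 | r11 => 11 | r12 => 12
  | r13 => 13 | r14 => 14 | r15 => 15 | r16 => 16 | r17 => 17 | r18 => 18
  | r19 => 19 | r20 => 20 | r21 => 21 | r22 => 22
  end.

Definition nat_res (k : nat) : res := nth r0 residues (k %% 23).

Definition tabulate2 A (f : res -> res -> A) (i j : res) : A :=
  tabulate (fun i => tabulate (f i) j) i.

Definition res_eq : res -> res -> bool :=
  Eval cbv in tabulate2 (fun i j => res_nat i == res_nat j).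
Definition res_add : res -> res -> res :=
  Eval cbv in tabulate2 (fun i j => nat_res (res_nat i + res_nat j)).
Definition res_sub : res -> res -> res :=
  Eval cbv in tabulate2 (fun i j => nat_res (res_nat i + (23 - res_nat j))).
Definition res_mul : res -> res -> res :=
  Eval cbv in tabulate2 (fun i j => nat_res (res_nat i * res_nat j)).
(** Division by [r0] always gives [r0], so two cells in the same row get slope [r0], which no
    forbidden triple has. *)
Definition res_div : res -> res -> res :=
  Eval cbv in tabulate2 (fun i j =>
    nth r0 residues (find (fun k => res_eq (res_mul k j) i) residues)).

Record vec (A : Type) : Type := Vec {
  a0 : A; a1 : A; a2 : A; a3 : A; a4 : A; a5 : A; a6 : A; a7 : A; a8 : A;
  a9 : A; a10 : A; a11 : A; a12 : A; a13 : A; a14 : A; a15 : A; a16 : A;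
  a17 : A; a18 : A; a19 : A; a20 : A; a21 : A; a22 : A }.

Definition vget A (m : vec A) (i : res) : A :=
  let: Vec
    a0 a1 a2 a3 a4 a5 a6 a7 a8 a9 a10 a11 a12 a13 a14 a15 a16 a17 a18 a19 a20
    a21 a22 := m in
  match i with
  | r0 => a0 | r1 => a1 | r2 => a2 | r3 => a3 | r4 => a4 | r5 => a5 | r6 => a6
  | r7 => a7 | r8 => a8 | r9 => a9 | r10 => a10 | r11 => a11 | r12 => a12
  | r13 => a13 | r14 => a14 | r15 => a15 | r16 => a16 | r17 => a17
  | r18 => a18 | r19 => a19 | r20 => a20 | r21 => a21 | r22 => a22
  end.

Definition vec_of A (f : res -> A) : vec A :=
  Vec (f r0) (f r1) (f r2) (f r3) (f r4) (f r5) (f r6) (f r7) (f r8) (f r9)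
  (f r10) (f r11) (f r12) (f r13) (f r14) (f r15) (f r16) (f r17) (f r18)
  (f r19) (f r20) (f r21) (f r22).

Definition vset : forall A, vec A -> res -> A -> vec A := Eval cbv in
  fun A (m : vec A) i v => let: Vec
    a0 a1 a2 a3 a4 a5 a6 a7 a8 a9 a10 a11 a12 a13 a14 a15 a16 a17 a18 a19 a20
    a21 a22 := m in
  tabulate (fun i => Vec
    (if res_eq i r0 then v else a0) (if res_eq i r1 then v else a1)
    (if res_eq i r2 then v else a2) (if res_eq i r3 then v else a3)
    (if res_eq i r4 then v else a4) (if res_eq i r5 then v else a5)
    (if res_eq i r6 then v else a6) (if res_eq i r7 then v else a7)
    (if res_eq i r8 then v else a8) (if res_eq i r9 then v else a9)
    (if res_eq i r10 then v else a10) (if res_eq i r11 then v else a11)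
    (if res_eq i r12 then v else a12) (if res_eq i r13 then v else a13)
    (if res_eq i r14 then v else a14) (if res_eq i r15 then v else a15)
    (if res_eq i r16 then v else a16) (if res_eq i r17 then v else a17)
    (if res_eq i r18 then v else a18) (if res_eq i r19 then v else a19)
    (if res_eq i r20 then v else a20) (if res_eq i r21 then v else a21)
    (if res_eq i r22 then v else a22)) i.

Definition vfold A B (g : res -> A -> B -> B) (m : vec A) (z : B) : B :=
  let: Vec
    a0 a1 a2 a3 a4 a5 a6 a7 a8 a9 a10 a11 a12 a13 a14 a15 a16 a17 a18 a19 a20
    a21 a22 := m in
  (g r0 a0 (g r1 a1 (g r2 a2 (g r3 a3 (g r4 a4 (g r5 a5 (g r6 a6 (g r7 a7
  (g r8 a8 (g r9 a9 (g r10 a10 (g r11 a11 (g r12 a12 (g r13 a13 (g r14 a14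
  (g r15 a15 (g r16 a16 (g r17 a17 (g r18 a18 (g r19 a19 (g r20 a20 (g r21 a21
  (g r22 a22 z))))))))))))))))))))))).

(** * Refutation trees *)

Definition cell : Type := res * res.

Variant role := First | Second | Third.

(* [Cycle b] excludes a cell because it closes a short cycle of v |-> pi v + b.
   [Pattern sw k x1 x2] excludes it because, put in position [k], it forms with
   the cells placed in rows [x1] and [x2] an image of a forbidden triple, after
   transposing all three cells if [sw]. *)
Inductive node :=
| Row of res & entries
| Col of res & entries
| Diff of res & entries
| Sum of res & entries
| Solved
with entries :=
| Done
| Cycle of res & entries
| Pattern of bool & role & res & res & entries
| Child of node & entries.

Record state := State {
  img : vec (option res);
  used_col : vec bool;
  used_diff : vec bool;
  used_sum : vec bool }.

Definition place (s : state) (x y : res) : state :=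
  let: State p q d m := s in
  State (vset p x (Some y)) (vset q y true)
        (vset d (res_sub y x) true) (vset m (res_add x y) true).

Definition patterns := vec (vec (vec bool)).

Definition has_pattern (t : patterns) (r u v : res) : bool :=
  vget (vget (vget t r) u) v.

Definition add_pattern (t : patterns) (r u v : res) : patterns :=
  vset t r (vset (vget t r) u (vset (vget (vget t r) u) v true)).

Fixpoint path_ends (n : nat) (p : vec (option res)) (b x v : res) : bool :=
  match vget p v with
  | None => res_eq v x
  | Some w => if n is n'.+1 then path_ends n' p b x (res_add w b) else false
  end.

(* Fuel 19 bounds the length of the closed cycle by 21. *)
Definition closes_cycle (p : vec (option res)) (b x y : res) : bool :=
  match vget p (res_add y b) with
  | None => false
  | Some w => path_ends 19 p b x (res_add w b)
  end.

Definition swap_cell (sw : bool) (c : cell) : cell :=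
  let: (x, y) := c in if sw then (y, x) else (x, y).

(** For [s] nonzero, the affine map of scale [s] in both coordinates that takes (0,0) to [c1] and
    (1,r) to [c2] takes (u,v) to [c3]. *)
Definition normalize (T : Type) (f : res -> res -> res -> T)
    (c1 c2 c3 : cell) : T :=
  let: (x1, y1) := c1 in let: (x2, y2) := c2 in let: (x3, y3) := c3 in
  let s := res_sub x2 x1 in
  f (res_div (res_sub y2 y1) s) (res_div (res_sub x3 x1) s)
    (res_div (res_sub y3 y1) s).

Definition in_role (T : Type) (k : role) (f : cell -> cell -> cell -> T)
    (c1 c2 c : cell) : T :=
  match k with
  | First => f c c1 c2
  | Second => f c1 c c2
  | Third => f c1 c2 c
  end.

Definition completes_pattern (t : patterns) (p : vec (option res)) (sw : bool)
    (k : role) (x1 x2 x y : res) : bool :=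
  match vget p x1, vget p x2 with
  | Some y1, Some y2 =>
    in_role k (normalize (has_pattern t))
      (swap_cell sw (x1, y1)) (swap_cell sw (x2, y2)) (swap_cell sw (x, y))
  | _, _ => false
  end.

Definition row_cells (s : state) (x : res) : seq cell :=
  let: State _ q d m := s in
  vfold (fun y (used : bool) (l : seq cell) =>
    if used then l else if vget d (res_sub y x) then l else
    if vget m (res_add x y) then l else (x, y) :: l) q [::].

(** [f] gives the column where the line meets each row: constant for a column, [x + d] for a
    difference, [m - x] for a sum. *)
Definition free_cells (f : res -> res) (s : state) : seq cell :=
  let: State p q d m := s in
  vfold (fun x (used : option res) (l : seq cell) =>
    if used is Some _ then l else
    let y := f x in
    if vget q y then l else if vget d (res_sub y x) then l else
    if vget m (res_add x y) then l else (x, y) :: l) p [::].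

Definition nonresidue : res -> bool :=
  Eval cbv in tabulate (fun x =>
    ~~ has (fun y => res_eq (res_mul y y) x) residues).

Definition res_abmap (a b x : res) : res :=
  res_mul (if nonresidue x then b else a) x.

Definition ab_pairs : seq (res * res) :=
  [:: (r5, r7); (r7, r5); (r10, r14); (r14, r10); (r11, r15); (r15, r11);
      (r20, r21); (r21, r20); (r5, r5); (r7, r7); (r10, r10); (r11, r11);
      (r14, r14); (r15, r15); (r17, r17); (r19, r19); (r20, r20); (r21, r21)].

Definition listed (p : vec (option res)) : bool :=
  has (fun ab => has (fun c =>
    (* [[a,b]] vanishes at 0, so [d] can only be the image of [-c]. *)
    if vget p (res_sub r0 c) is Some d then
      all (fun x => if vget p x is Some y then
        res_eq y (res_add (res_abmap ab.1 ab.2 (res_add x c)) d) else false)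
        residues
    else false) residues) ab_pairs.

(** Entries carry no coordinates: the cells still free on the named line are recomputed in a fixed
    order and consumed one by one. An occupied line is rejected, since its cell is no longer among
    the free ones. *)
Fixpoint refutes (t : patterns) (c : node) (s : state) : bool :=
  match c with
  | Row x e =>
    if vget (img s) x is Some _ then false
    else refutes_all t e (row_cells s x) s
  | Col y e =>
    if vget (used_col s) y then false
    else refutes_all t e (free_cells (fun=> y) s) s
  | Diff d e =>
    if vget (used_diff s) d then false
    else refutes_all t e (free_cells (fun x => res_add x d) s) s
  | Sum m e =>
    if vget (used_sum s) m then false
    else refutes_all t e (free_cells (fun x => res_sub m x) s) s
  | Solved => listed (img s)
  end
with refutes_all (t : patterns) (e : entries) (l : seq cell) (s : state) :=
  match e, l with
  | Done, [::] => true
  | Cycle b e, (x, y) :: l =>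
    if closes_cycle (img s) b x y then refutes_all t e l s else false
  | Pattern sw k x1 x2 e, (x, y) :: l =>
    if completes_pattern t (img s) sw k x1 x2 x y then refutes_all t e l s
    else false
  | Child c e, (x, y) :: l =>
    if refutes t c (place s x y) then refutes_all t e l s else false
  | _, _ => false
  end.

Definition empty_state : state :=
  State (vec_of (fun=> None)) (vec_of (fun=> false)) (vec_of (fun=> false))
        (vec_of (fun=> false)).

Definition origin_state : state := place empty_state r0 r0.

Definition pattern_state (r u v : res) : state :=
  place (place origin_state r1 r) u v.

(** Each tree may use only the triples refuted before it; the last one starts from (0,0) alone and
    may use them all. *)
Fixpoint refutes_list (t : patterns) (ps : seq (res * res * res))
    (cs : seq node) : bool :=
  match ps, cs with
  | [::], [:: c] => refutes t c origin_state
  | (r, u, v) :: ps, c :: cs =>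
    [&& ~~ res_eq r r0, refutes t c (pattern_state r u v)
      & refutes_list (add_pattern t r u v) ps cs]
  | _, _ => false
  end.

(** * Search *)

Variant status :=
| Open
| ByCycle of res
| ByPattern of bool & role & res & res.

Record candidate := Candidate {
  cand_row : res; cand_col : res; cand_diff : res; cand_sum : res;
  cand_status : status }.

(** Excluded candidates are kept with their reason, because the checker expects an entry for each;
    cells on occupied lines are dropped, as the checker skips them. *)
Record search_state := SearchState {
  forward : vec (option res); backward : vec (option res);
  edges : seq cell; candidates : seq candidate;
  row_load : vec nat; col_load : vec nat;
  diff_load : vec nat; sum_load : vec nat }.

Fixpoint path_last (n : nat) (p : vec (option res)) (b v : res) : res :=
  match vget p v, n with
  | Some w, n'.+1 => path_last n' p b (res_add w b)
  | _, _ => v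
  end.

Fixpoint path_first (n : nat) (q : vec (option res)) (b v : res) : res :=
  match vget q (res_sub v b), n with
  | Some w, n'.+1 => path_first n' q b w
  | _, _ => v
  end.

Definition kill_table := vec (seq (res * status)).

Definition kill (k : kill_table) (x y : res) (a : status) : kill_table :=
  vset k x ((y, a) :: vget k x).

Fixpoint killed (l : seq (res * status)) (y : res) : status :=
  if l is (z, a) :: l' then if res_eq y z then a else killed l' y else Open.

(** The new cell lies on a path of [v |-> pi v + b], which the cell leading from its last point back
    to its first would close. For [b = x - y] the path is the fixed point [x]. *)
Definition cycle_kills p q (x y : res) (k : kill_table) : kill_table :=
  let fixing := res_sub x y in
  foldl (fun k b => if res_eq b fixing then k else
    kill k (path_last 22 p b (res_add y b))
      (res_sub (path_first 22 q b x) b) (ByCycle b)) k residues.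

Definition completions := vec (seq (cell * (bool * role * bool))).

(** All ways to meet the triple with one cell missing: transposed or not, three choices of the
    missing cell, two orders of the other two. They are indexed by the slope of the two present
    cells. *)
Definition add_completions (t : completions) (r u v : res) : completions :=
  let add t a c1 c2 c := normalize (fun r u v =>
    vset t r (((u, v), a) :: vget t r)) c1 c2 c in
  foldl (fun t sw =>
    let c1 := swap_cell sw (r0, r0) in
    let c2 := swap_cell sw (r1, r) in
    let c3 := swap_cell sw (u, v) in
    foldl (fun t kc => let: (k, ca, cb, c) := kc in
      add (add t (sw, k, false) ca cb c) (sw, k, true) cb ca c)
      t [:: (First, c2, c3, c1); (Second, c1, c3, c2); (Third, c1, c2, c3)])
    t [:: false; true].

Definition pattern_kills (t : completions) (es : seq cell) (x y : res)
    (k : kill_table) : kill_table :=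
  foldl (fun k e => let: (x1, y1) := e in
    let s := res_sub x x1 in
    foldl (fun k f => let: ((u, v), (sw, o, flip)) := f in
      kill k (res_add x1 (res_mul s u)) (res_add y1 (res_mul s v))
        (if flip then ByPattern sw o x x1 else ByPattern sw o x1 x))
      k (vget t (res_div (res_sub y y1) s))) k es.

(* A load of 24 marks a line that already carries its cell.  From 21 cells on, a
   closed cycle may be one of the admissible 22-cycles, so none is excluded. *)
Definition search_place (t : completions) (s : search_state) (x y : res) :=
  let: SearchState p q es l ra ca da sa := s in
  let d := res_sub y x in
  let m := res_add x y in
  let k := pattern_kills t es x y (vec_of (fun=> [::])) in
  let k := if size es < 20 then cycle_kills p q x y k else k in
  let l := foldr (fun c l => let: Candidate x' y' d' m' a := c in
    if res_eq x x' then l else if res_eq y y' then l else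
    if res_eq d d' then l else if res_eq m m' then l else
    if a is Open then Candidate x' y' d' m' (killed (vget k x') y') :: l
    else c :: l) [::] l in
  SearchState (vset p x (Some y)) (vset q y (Some x)) ((x, y) :: es) l
    (vset ra x 24) (vset ca y 24) (vset da d 24) (vset sa m 24).

Definition incr (m : vec nat) (i : res) : vec nat := vset m i (vget m i).+1.

Definition loads (s : search_state) : vec nat * vec nat * vec nat * vec nat :=
  foldl (fun ms c =>
    if c is Candidate x y d m Open then
      let: (ra, ca, da, sa) := ms in
      (incr ra x, incr ca y, incr da d, incr sa m)
    else ms) (row_load s, col_load s, diff_load s, sum_load s) (candidates s).

Definition line : Type := (res -> entries -> node) * (candidate -> res) * res.

(** Comparing strictly from 24 down never picks an occupied line, and a line without open candidates
    is preferred to any other. *)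
Definition lighter mk proj (m : vec nat) (z : nat * option line) :=
  vfold (fun i c z => if Nat.ltb c z.1 then (c, Some (mk, proj, i)) else z) m z.

Definition lightest_line (s : search_state) : option line :=
  let: (ra, ca, da, sa) := loads s in
  (lighter Sum cand_sum sa (lighter Diff cand_diff da
    (lighter Col cand_col ca (lighter Row cand_row ra (24, None))))).2.

(** Candidates stay sorted by row and then by column, the order in which the checker enumerates a
    line. *)
Fixpoint search (n : nat) (t : completions) (s : search_state) : node :=
  if n isn't n'.+1 then Solved else
  if lightest_line s is Some (mk, proj, i) then
    mk i (foldr (fun c e => if res_eq (proj c) i then
      match cand_status c with
      | Open =>
        Child (search n' t (search_place t s (cand_row c) (cand_col c))) e
      | ByCycle b => Cycle b e
      | ByPattern sw k x1 x2 => Pattern sw k x1 x2 e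
      end else e) Done (candidates s))
  else Solved.

Definition search_from (t : completions) (l : seq cell) : node :=
  search 24 t (foldl (fun s e => search_place t s e.1 e.2)
    (SearchState (vec_of (fun=> None)) (vec_of (fun=> None)) [::]
      (flatten [seq [seq Candidate x y (res_sub y x) (res_add x y) Open
        | y <- residues] | x <- residues])
      (vec_of (fun=> 0)) (vec_of (fun=> 0)) (vec_of (fun=> 0))
      (vec_of (fun=> 0))) l).

(* Chosen greedily to keep the trees small: about 927000 nodes in total. *)
Definition pattern_list : seq (res * res * res) :=
  [:: (r4, r2, r19); (r4, r7, r8); (r5, r2, r19); (r2, r2, r19);
      (r3, r11, r6); (r7, r6, r16); (r2, r9, r21); (r4, r2, r17);
      (r4, r2, r9); (r3, r2, r19); (r2, r10, r4); (r2, r11, r4);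
      (r3, r4, r11); (r2, r2, r17); (r3, r5, r6); (r3, r6, r7); (r4, r9, r17);
      (r7, r2, r17); (r3, r2, r20); (r3, r2, r17); (r11, r3, r22);
      (r2, r9, r4); (r4, r6, r16); (r2, r7, r4); (r7, r7, r17); (r2, r12, r4);
      (r2, r9, r12); (r2, r9, r8); (r2, r7, r21); (r5, r6, r9)].

(** Tree [n] starts from triple [n], or from (0,0) alone past the end of the list, and uses the
    triples before it. *)
Definition certificate (n : nat) : node :=
  search_from
    (foldl (fun t p => let: (r, u, v) := p in add_completions t r u v)
      (vec_of (fun=> [::])) (take n pattern_list))
    ((r0, r0) :: if drop n pattern_list is (r, u, v) :: _
      then [:: (r1, r); (u, v)] else [::]).

(* The first four trees are separate definitions only to bound memory use. *)
Definition certificate0 : node := Eval vm_compute in certificate 0.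
Definition certificate1 : node := Eval vm_compute in certificate 1.
Definition certificate2 : node := Eval vm_compute in certificate 2.
Definition certificate3 : node := Eval vm_compute in certificate 3.
Definition certificates : seq node :=
  Eval vm_compute in [seq certificate n | n <- iota 4 27].

Definition no_pattern : patterns :=
  vec_of (fun=> vec_of (fun=> vec_of (fun=> false))).

(** The evaluation is left to the kernel at [Qed], so that it runs only once. *)
Lemma certificates_refute : refutes_list no_pattern pattern_list
  [:: certificate0, certificate1, certificate2, certificate3 & certificates].
Proof. by vm_cast_no_check (erefl true). Qed.

(** * Symmetries *)

Local Open Scope ring_scope.

Local Notation Z := 'Z_23.

(** * Residues as elements of the ring of integers modulo 23 *)

Lemma res_natK : cancel res_nat nat_res. Proof. by case. Qed.

HB.instance Definition _ := Equality.copy res (can_type res_natK).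

Lemma res_nat_lt i : (res_nat i < 23)%N. Proof. by case: i. Qed.

Lemma nat_resK k : (k < 23)%N -> res_nat (nat_res k) = k.
Proof. by move: k; do 23 (case=> //). Qed.

Lemma all_resP (P : pred res) : all P residues -> forall i, P i.
Proof.
move=> /(all_nthP r0) Pres i.
by rewrite -[i]res_natK /nat_res; apply: Pres; rewrite modn_small ?res_nat_lt.
Qed.

Lemma all_res2P (P : res -> res -> bool) :
  all (fun i => all (P i) residues) residues -> forall i j, P i j.
Proof. by move=> /all_resP Pres i; apply/all_resP/Pres. Qed.

Lemma mem_residues i : i \in residues. Proof. by case: i. Qed.

Lemma res_eqE i j : res_eq i j = (i == j).
Proof. by apply/eqP; move: i j; apply: all_res2P; vm_compute. Qed.

Definition zval (i : res) : Z := (res_nat i)%:R.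

Lemma zval_mod i k : res_nat i = k %[mod 23] -> zval i = k%:R.
Proof.
by move=> eq_ik; rewrite /zval -(Zp_nat_mod _ k) // -eq_ik Zp_nat_mod.
Qed.

Lemma val_zval i : zval i = res_nat i :> nat.
Proof. by rewrite /zval val_Zp_nat // modn_small // res_nat_lt. Qed.

Lemma zval_inj : injective zval.
Proof.
move=> i j /(congr1 (@nat_of_ord _)); rewrite !val_zval.
exact: (can_inj res_natK).
Qed.

Lemma zvalP (x : Z) : exists i, x = zval i.
Proof.
by exists (nat_res x); apply: val_inj; rewrite /= val_zval nat_resK //.
Qed.

Lemma zvalD i j : zval (res_add i j) = zval i + zval j.
Proof.
rewrite -natrD; apply: zval_mod; apply/eqP; move: i j.
by apply: all_res2P; vm_compute.
Qed.

Lemma zvalM i j : zval (res_mul i j) = zval i * zval j.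
Proof.
rewrite -natrM; apply: zval_mod; apply/eqP; move: i j.
by apply: all_res2P; vm_compute.
Qed.

Lemma zvalB i j : zval (res_sub i j) = zval i - zval j.
Proof.
apply/esym/(canLR (addrK _)); rewrite -zvalD; congr zval; apply/eqP.
by rewrite eq_sym; move: i j; apply: all_res2P; vm_compute.
Qed.

Lemma zval0 : zval r0 = 0. Proof. by []. Qed.
Lemma zval1 : zval r1 = 1. Proof. by []. Qed.

Lemma res_divK i j : j != r0 -> res_mul (res_div i j) j = i.
Proof.
move=> j_neq0; apply/eqP; apply: contraR j_neq0; apply/implyP.
by move: i j; apply: all_res2P; vm_compute.
Qed.

Lemma res_div0 i : res_div i r0 = r0. Proof. by case: i. Qed.

Lemma vget_of A (f : res -> A) i : vget (vec_of f) i = f i.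
Proof. by case: i. Qed.

Lemma vget_set A (m : vec A) i v j :
  vget (vset m i v) j = if i == j then v else vget m j.
Proof. by rewrite -res_eqE; case: m => *; case: i; case: j. Qed.

Lemma vfoldE A B (g : res -> A -> B -> B) m z :
  vfold g m z = foldr (fun i => g i (vget m i)) z residues.
Proof. by case: m. Qed.

(** * Good maps and the symmetries that preserve them *)

Definition shift (f : Z -> Z) (b v : Z) : Z := f v + b.

(** Translation by [b] conjugates [x |-> f (x + b)] to [shift f b], so the two have the same cycle
    lengths. *)
Record good (f : Z -> Z) : Prop := Good {
  good_inj : injective f;
  good_diff : injective (fun x => f x - x);
  good_cycle : forall b x k, (0 < k < 22)%N ->
    iter k (shift f b) x = x -> shift f b x = x }.

Definition ab_zpairs : seq (Z * Z) :=
  [seq (zval ab.1, zval ab.2) | ab <- ab_pairs].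

Definition listed_fun (f : Z -> Z) : bool :=
  [exists a, exists b, exists c, exists d, ((a, b) \in ab_zpairs) &&
    [forall x, f x == abmap a b (x + c) + d]].

Lemma listed_funP f : reflect (exists a b c d, (a, b) \in ab_zpairs /\
    forall x, f x = abmap a b (x + c) + d) (listed_fun f).
Proof.
apply: (iffP existsP) => [[a /existsP[b /existsP[c /existsP[d]]]]|].
  by move=> /andP[abP /forallP fE]; exists a, b, c, d; split=> // x; apply/eqP.
move=> [a [b [c [d [abP fE]]]]]; exists a; apply/existsP; exists b.
apply/existsP; exists c; apply/existsP; exists d; rewrite abP /=.
by apply/forallP => x; rewrite fE.
Qed.

(** Triples are forbidden for bad maps only: a listed map may contain one, and its branch then ends
    in a [Solved] leaf. *)
Definition bad (f : Z -> Z) : Prop := good f /\ ~~ listed_fun f.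

Lemma is_sq_zval x : is_sq (zval x) = ~~ nonresidue x.
Proof.
have -> : nonresidue x = ~~ has (fun y => res_eq (res_mul y y) x) residues.
  by case: x.
rewrite negbK; apply/existsP/hasP => [[y]|[i _]].
  have [i ->] := zvalP y; rewrite -zvalM => /eqP/zval_inj ix.
  by exists i; rewrite ?mem_residues // ix res_eqE.
by rewrite res_eqE => /eqP <-; exists (zval i); rewrite zvalM.
Qed.

Lemma abmap_zval a b x :
  abmap (zval a) (zval b) (zval x) = zval (res_abmap a b x).
Proof.
by rewrite /abmap is_sq_zval /res_abmap; case: nonresidue; rewrite zvalM.
Qed.

Lemma ab_zpairsP a b : (a, b) \in ab_zpairs ->
  exists i j, [/\ (i, j) \in ab_pairs, a = zval i & b = zval j].
Proof. by move=> /mapP[[i j] ijP [-> ->]]; exists i, j. Qed.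

(** Conjugation by a square fixes [[a,b]], conjugation by a nonsquare gives [[b,a]], and the list is
    closed under this exchange. *)
Lemma abmap_scale a b s s' : (a, b) \in ab_zpairs -> s * s' = 1 ->
  exists a' b', (a', b') \in ab_zpairs /\
    forall z, s * abmap a b (s' * z) = abmap a' b' z.
Proof.
move=> /ab_zpairsP[i [j [ijP -> ->]]] ss'.
have [k sE] := zvalP s; have [k' s'E] := zvalP s'.
move: ss'; rewrite sE s'E -zvalM -zval1 => /zval_inj kk'.
have chk : all (fun ij => all (fun k => all (fun k' =>
    if res_mul k k' == r1 then has (fun ij' => all (fun z =>
      res_mul k (res_abmap ij.1 ij.2 (res_mul k' z)) == res_abmap ij'.1 ij'.2 z)
      residues) ab_pairs else true) residues) residues) ab_pairs.
  by vm_compute.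
move/allP: chk => /(_ _ ijP) /all_res2P /(_ k k'); rewrite kk' eqxx.
move=> /hasP[[i' j'] ijP' /all_resP H].
exists (zval i'), (zval j'); split=> [|z]; first by apply/mapP; exists (i', j').
by have [n ->] := zvalP z; rewrite -zvalM !abmap_zval -zvalM (eqP (H n)).
Qed.

(** All listed multipliers are nonsquares, so [[a,b]] exchanges nonzero squares and nonsquares and
    its inverse is [[b^-1,a^-1]], again listed. *)
Lemma abmap_inverse a b : (a, b) \in ab_zpairs ->
  exists a' b', (a', b') \in ab_zpairs /\ cancel (abmap a' b') (abmap a b).
Proof.
move=> /ab_zpairsP[i [j [ijP -> ->]]].
have chk : all (fun ij => has (fun ij' => all (fun z =>
    res_abmap ij.1 ij.2 (res_abmap ij'.1 ij'.2 z) == z) residues) ab_pairs)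
    ab_pairs by vm_compute.
move/allP: chk => /(_ _ ijP) /hasP[[i' j'] ijP' /all_resP H].
exists (zval i'), (zval j'); split=> [|z]; first by apply/mapP; exists (i', j').
by have [n ->] := zvalP z; rewrite !abmap_zval (eqP (H n)).
Qed.

Definition renormalize (f : Z -> Z) (s s' t w : Z) (x : Z) : Z :=
  s' * (f (s * x + t) - w).

Lemma bad_renormalize f s s' t w : s * s' = 1 -> bad f ->
  bad (renormalize f s s' t w).
Proof.
move=> ss' [[f_inj f_diff f_cycle] f_unlisted]; rewrite /renormalize.
have mulKs x y : s * x = s * y -> x = y.
  by move=> /(congr1 ( *%R s')); rewrite !mulrA (mulrC s') ss' !mul1r.
have mulKs' x y : s' * x = s' * y -> x = y.
  by move=> /(congr1 ( *%R s)); rewrite !mulrA ss' !mul1r.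
(* The map [x |-> s * x + t] conjugates each shift of the new map to a shift of [f], so short cycles
   correspond. *)
have conj b k x : s * iter k (shift (renormalize f s s' t w) b) x + t =
    iter k (shift f (s * b + t - w)) (s * x + t).
  elim: k => //= k <-; rewrite /shift /renormalize mulrDr mulrA ss' mul1r.
  by ring.
split; first split=> [x y /mulKs' /addIr /f_inj /addIr /mulKs //| x y eq_xy |].
- apply: mulKs; apply: (addIr t); apply: f_diff.
  move/(congr1 ( *%R s)): eq_xy; rewrite !mulrBr !mulrA !ss' !mul1r => eq_xy.
  have E z : f (s * z + t) - (s * z + t) = f (s * z + t) - w - s * z + (w - t).
    by ring.
  by rewrite !E eq_xy.
- move=> b x k k_bnd kx.
  have := f_cycle (s * b + t - w) (s * x + t) k k_bnd.
  rewrite -conj kx => /(_ erefl); rewrite -[shift f _ _](conj b 1).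
  by move=> /addIr /mulKs.
apply: contra f_unlisted => /listed_funP[a [b [c [d [abP gE]]]]].
have [a' [b' [abP' scaleE]]] := abmap_scale abP ss'.
(* Obtained by solving for [f y = s * g (s' * (y - t)) + w], with [g] the renormalized map. *)
apply/listed_funP; exists a', b', (s * c - t), (s * d + w); split=> // y.
have -> : f y = s * renormalize f s s' t w (s' * (y - t)) + w.
  by rewrite /renormalize !mulrA ss' !mul1r subrK subrK.
rewrite /renormalize gE mulrDr -addrA; congr (_ + _).
rewrite -scaleE; congr (s * abmap a b _).
by rewrite -[in LHS](mul1r c) -ss' [s * s']mulrC; ring.
Qed.

Lemma bad_inverse f g : cancel f g -> cancel g f -> bad f -> bad g.
Proof.
move=> fK gK [[f_inj f_diff f_cycle] f_unlisted].
split; first split; first exact: can_inj gK.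
- move=> x y eq_xy.
  have E z : f (g z) - g z = - (g z - z) by rewrite gK opprB.
  by rewrite -[x]gK -[y]gK; congr f; apply: f_diff; rewrite !E eq_xy.
- move=> b x k k_bnd kx.
  (* After translation by [-b], iterating [shift f (- b)] runs the orbits of [shift g b]
     backwards. *)
  have back j y : iter j (shift f (- b)) (iter j (shift g b) y - b) = y - b.
    elim: j y => // j IHj y; rewrite iterSr iterS /shift.
    by rewrite [g _ + b - b]addrK gK -/(shift f _) IHj.
  have := back k x; rewrite kx => /(f_cycle (- b) (x - b) k k_bnd) /addIr fx.
  by rewrite /shift -{1}fx fK subrK.
apply: contra f_unlisted => /listed_funP[a [b [c [d [abP gE]]]]].
have [a' [b' [abP' abK]]] := abmap_inverse abP.
apply/listed_funP; exists a', b', (- d), (- c); split=> // x.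
by apply: (can_inj gK); rewrite fK gE subrK abK subrK.
Qed.

(** * Soundness of refutation trees *)

Definition on (f : Z -> Z) (c : cell) : Prop := f (zval c.1) = zval c.2.

(** Marked lines must hold a placed cell, so that no cell of [f] is wrongly filtered out; conversely
    placed cells must mark their lines, so that on an unmarked line the cell of [f] is still to be
    placed. *)
Record extends (f : Z -> Z) (s : state) : Prop := Extends {
  ext_img : forall x y, vget (img s) x = Some y -> f (zval x) = zval y;
  ext_col : forall y, vget (used_col s) y -> exists x, vget (img s) x = Some y;
  ext_diff : forall d, vget (used_diff s) d ->
    exists x y, vget (img s) x = Some y /\ res_sub y x = d;
  ext_sum : forall m, vget (used_sum s) m ->
    exists x y, vget (img s) x = Some y /\ res_add x y = m;
  ext_used : forall x y, vget (img s) x = Some y ->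
    [/\ vget (used_col s) y, vget (used_diff s) (res_sub y x)
      & vget (used_sum s) (res_add x y)] }.

Definition forbidden (t : patterns) : Prop := forall r u v,
  has_pattern t r u v -> r != r0 /\ forall f, bad f ->
    on f (r0, r0) -> on f (r1, r) -> on f (u, v) -> False.

Lemma extends_empty f : extends f empty_state.
Proof. by split=> [x y|y|d|m|x y]; rewrite vget_of. Qed.

Lemma extends_place f s x y : extends f s -> on f (x, y) ->
  extends f (place s x y).
Proof.
case: s => p q d m [/= Ep Eq Ed Em Eu] fxy.
(* If row [x] is already filled, its old value is overwritten by the same value, both being given by
   [f]. *)
have keep x0 y0 : vget p x0 = Some y0 -> vget (vset p x (Some y)) x0 = Some y0.
  move=> p0; rewrite vget_set; case: eqP => // eq_x; congr Some.
  by apply: zval_inj; rewrite -fxy -(Ep _ _ p0) /= eq_x.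
have new : vget (vset p x (Some y)) x = Some y by rewrite vget_set eqxx.
split=> /=.
- by move=> x0 y0; rewrite vget_set; case: eqP => [<- [<-] //|_]; apply: Ep.
- move=> y0; rewrite vget_set; case: eqP => [<-|_ /Eq[x0 /keep]].
    by exists x.
  by exists x0.
- move=> d0; rewrite vget_set; case: eqP => [<-|_ /Ed[x0 [y0 [/keep]]]].
    by exists x, y.
  by exists x0, y0.
- move=> m0; rewrite vget_set; case: eqP => [<-|_ /Em[x0 [y0 [/keep]]]].
    by exists x, y.
  by exists x0, y0.
- move=> x0 y0; rewrite !vget_set; case: eqP => [<- [<-]|_ /Eu[-> -> ->]].
    by rewrite !eqxx.
  by split; case: ifP.
Qed.

(* Two cells with the same sum x + y form a 2-cycle of a shift. *)
Lemma good_sum f x x' : good f -> f x + x = f x' + x' -> x = x'.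
Proof.
move=> [_ _ f_cycle] eq_sum.
have E : shift f (x' - f x) x = x' by rewrite /shift addrC subrK.
rewrite -E; apply/esym; apply: (f_cycle _ _ 2%N) => //=.
by rewrite E /shift addrA -eq_sum [f x + x]addrC addrK.
Qed.

Scheme node_mut_ind := Induction for node Sort Prop
with entries_mut_ind := Induction for entries Sort Prop.

Section Soundness.

Variables (t : patterns) (f : Z -> Z).
Hypotheses (tP : forbidden t) (f_bad : bad f).

Let f_good : good f. Proof. by case: f_bad. Qed.

Section State.

Variable s : state.
Hypothesis sP : extends f s.

Lemma free_col x y : vget (img s) x = None -> on f (x, y) ->
  vget (used_col s) y = false.
Proof.
move=> px fxy; apply/negP => /(ext_col sP)[x' px'].
have := ext_img sP px'; rewrite /on /= -fxy => /(good_inj f_good)/zval_inj xx'.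
by rewrite xx' px in px'.
Qed.

Lemma free_diff x y : vget (img s) x = None -> on f (x, y) ->
  vget (used_diff s) (res_sub y x) = false.
Proof.
move=> px fxy; apply/negP => /(ext_diff sP)[x' [y' [px' /(congr1 zval)]]].
have fx' := ext_img sP px'.
rewrite !zvalB -[zval y]fxy -fx' => /(good_diff f_good)/zval_inj xx'.
by rewrite xx' px in px'.
Qed.

Lemma free_sum x y : vget (img s) x = None -> on f (x, y) ->
  vget (used_sum s) (res_add x y) = false.
Proof.
move=> px fxy; apply/negP => /(ext_sum sP)[x' [y' [px' /(congr1 zval)]]].
have fx' := ext_img sP px'.
rewrite !zvalD -[zval y]fxy -fx' ![zval _ + _]addrC.
by move=> /(good_sum f_good)/zval_inj xx'; rewrite xx' px in px'.
Qed.

(** Completeness of the enumeration: the cell of [f] in an unfilled row meets no occupied column,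
    difference or sum, so it survives the filters. *)
Lemma mem_row_cells x y : vget (img s) x = None -> on f (x, y) ->
  (x, y) \in row_cells s x.
Proof.
move=> px fxy; have := free_sum px fxy; have := free_diff px fxy.
have := free_col px fxy; rewrite /row_cells; case: (s) => p q d m /= qy dy my.
rewrite vfoldE; move: (mem_residues y).
elim: residues => //= i l IHl; rewrite inE => /orP[/eqP <-|/IHl yl].
  by rewrite qy dy my mem_head.
by do 3 (case: ifP => // _); rewrite inE yl orbT.
Qed.

Lemma mem_free_cells g x : vget (img s) x = None -> on f (x, g x) ->
  (x, g x) \in free_cells g s.
Proof.
move=> px fxy; have := free_sum px fxy; have := free_diff px fxy.
have := free_col px fxy; rewrite /free_cells.
case: (s) px => p q d m /= px qy dy my.
rewrite vfoldE; move: (mem_residues x).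
elim: residues => //= i l IHl; rewrite inE => /orP[/eqP <-|/IHl yl].
  by rewrite px qy dy my mem_head.
by case: (vget p i) => //; do 3 (case: ifP => // _); rewrite inE yl orbT.
Qed.

Lemma path_ends_sound n b x v : path_ends n (img s) b x v ->
  exists2 k, (k <= n)%N & iter k (shift f (zval b)) (zval v) = zval x.
Proof.
elim: n v => [|n IHn] v /=; case pv: (vget _ v) => [w|] //.

- by rewrite res_eqE => /eqP ->; exists 0%N.
- move=> /IHn[k le_kn kx]; exists k.+1 => //; rewrite iterSr.
  by rewrite /shift (ext_img sP pv) -zvalD.
by rewrite res_eqE => /eqP ->; exists 0%N.
Qed.

(** The closed cycle has length at most 19 + 2 = 21, hence is a fixed point by goodness; then
    [y + b] is [x], which has no image yet. *)
Lemma closes_cycle_sound b x y : vget (img s) x = None -> on f (x, y) ->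
  closes_cycle (img s) b x y -> False.
Proof.
move=> px fxy; rewrite /closes_cycle; case pv: (vget _ _) => [w|] //.
move=> /path_ends_sound[k le_k kx].
have E : shift f (zval b) (zval x) = zval (res_add y b).
  by rewrite /shift fxy zvalD.
have E' : shift f (zval b) (zval (res_add y b)) = zval (res_add w b).
  by rewrite /shift (ext_img sP pv) zvalD.
have : shift f (zval b) (zval x) = zval x.
  apply: (good_cycle f_good (k := k.+2)).
    by rewrite !ltnS (leq_trans le_k).
  by rewrite !iterSr E E'.
by rewrite E => /zval_inj yb; rewrite yb px in pv.
Qed.

Lemma listed_sound : listed (img s) -> False.
Proof.
case: f_bad => _ /negP f_unlisted /hasP[[a b] abP /hasP[c _]].
case: (vget _ _) => [d|] // /all_resP H; apply: f_unlisted.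
apply/listed_funP; exists (zval a), (zval b), (zval c), (zval d); split.
  by apply/mapP; exists (a, b).
move=> x; have [i ->] := zvalP x; have := H i; case pi: (vget _ _) => [y|] //.
rewrite res_eqE => /eqP yE; rewrite (ext_img sP pi) /= yE.
by rewrite zvalD -abmap_zval zvalD.
Qed.

End State.

(** Renormalizing [g] along the first two cells gives a bad map through the forbidden triple
    itself. *)
Lemma normalized_sound g c1 c2 c3 : bad g -> on g c1 -> on g c2 -> on g c3 ->
  normalize (has_pattern t) c1 c2 c3 -> False.
Proof.
case: c1 c2 c3 => [x1 y1] [x2 y2] [x3 y3] g_bad; rewrite /on /= => g1 g2 g3.
rewrite /normalize; set s := res_sub x2 x1; move=> /tP[r_neq0 noPat].
(* Were [s] zero, the slope would be [r0] by the convention for division. *)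
have s_neq0 : s != r0 by apply: contraNneq r_neq0 => ->; rewrite res_div0.
have divE i : zval (res_div i s) * zval s = zval i by rewrite -zvalM res_divK.
have ss' : zval s * zval (res_div r1 s) = 1 by rewrite mulrC divE.
have divE' i : zval (res_div i s) = zval (res_div r1 s) * zval i.
  by rewrite -(divE i) mulrCA [_ * zval s]mulrC ss' mulr1.
apply: (noPat _ (bad_renormalize (zval x1) (zval y1) ss' g_bad));
  rewrite /on /renormalize /=.
- by rewrite zval0 mulr0 add0r g1 subrr mulr0.
- by rewrite zval1 mulr1 zvalB subrK g2 divE' zvalB.
- by rewrite [zval s * _]mulrC divE zvalB subrK g3 divE' zvalB.
Qed.

Lemma completes_pattern_sound s sw k x1 x2 x y : extends f s -> on f (x, y) ->
  completes_pattern t (img s) sw k x1 x2 x y -> False.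
Proof.
move=> sP fxy; rewrite /completes_pattern.
case p1: (vget _ _) => [y1|] //; case p2: (vget _ _) => [y2|] //.
have f1 : on f (x1, y1) := ext_img sP p1.
have f2 : on f (x2, y2) := ext_img sP p2.
(* Transposing the cells replaces [f] by its inverse, which is also bad. *)
have [g g_bad gP] : exists2 g, bad g &
    forall c, on f c -> on g (swap_cell sw c).
  case: sw; last by exists f => // -[].
  have [f' fK f'K] := injF_bij (good_inj f_good).
  exists f'; first exact: bad_inverse fK f'K f_bad.
  by move=> [u v]; rewrite /on /= => <-; rewrite fK.
by case: k; apply: (normalized_sound g_bad); apply: gP.
Qed.

Lemma refutes_sound c s : refutes t c s -> extends f s -> False.
Proof.
pose P c := forall s, refutes t c s -> extends f s -> False.
(* Invariant for entries: none of the listed cells in an unfilled row belongs to [f]. *)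
pose Q e := forall l s, refutes_all t e l s -> extends f s ->
  forall x y, (x, y) \in l -> vget (img s) x = None -> on f (x, y) -> False.
(* The inverses of [f x], [f x - x] and [f x + x] locate the cell of [f] on a given column,
   difference or sum line. *)
have [f' fK f'K] := injF_bij (good_inj f_good).
have [d' dK d'K] := injF_bij (good_diff f_good).
have [m' mK m'K] := injF_bij (fun x y => @good_sum f x y f_good).
have line g e s' x : Q e -> refutes_all t e (free_cells g s') s' ->
    extends f s' -> f (zval x) = zval (g x) ->
    (forall y, g x = y -> vget (img s') x <> Some y) -> False.
  move=> IHe ref s'P fx no_img.
  have px : vget (img s') x = None.
    case px: (vget _ _) => [y|] //; case: (no_img y) => //; apply: zval_inj.
    by rewrite -fx; apply: (ext_img s'P px).
  exact: (IHe _ _ ref s'P _ _ (mem_free_cells s'P px fx) px fx).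
move: s; apply: (@node_mut_ind P Q) c => [x e IHe|y e IHe|d e IHe|m e IHe||
    |b e IHe|sw k x1 x2 e IHe|c IHc e IHe]; rewrite /P /Q /=.
- move=> s; case px: (vget _ _) => // ref sP; have [y fx] := zvalP (f (zval x)).
  exact: (IHe _ _ ref sP _ _ (mem_row_cells sP px fx) px fx).
- move=> s; case: ifP => // qy ref sP; have [x f'y] := zvalP (f' (zval y)).
  have fx : f (zval x) = zval y by rewrite -f'y f'K.
  apply: (line _ _ _ x IHe ref sP fx) => _ <- /(ext_used sP)[].
  by rewrite qy.
- move=> s; case: ifP => // dd ref sP; have [x d'd] := zvalP (d' (zval d)).
  have fx : f (zval x) = zval (res_add x d).
    by rewrite zvalD -(d'K (zval d)) d'd addrC subrK.
  apply: (line _ _ _ x IHe ref sP fx) => _ <- /(ext_used sP)[_].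
  have -> : res_sub (res_add x d) x = d.
    by apply: zval_inj; rewrite zvalB zvalD addrC addKr.
  by rewrite dd.
- move=> s; case: ifP => // mm ref sP; have [x m'm] := zvalP (m' (zval m)).
  have fx : f (zval x) = zval (res_sub m x).
    by rewrite zvalB -(m'K (zval m)) m'm addrK.
  apply: (line _ _ _ x IHe ref sP fx) => _ <- /(ext_used sP)[_ _].
  have -> : res_add x (res_sub m x) = m.
    by apply: zval_inj; rewrite zvalD zvalB addrC subrK.
  by rewrite mm.
- by move=> s ref sP; apply: (listed_sound sP ref).
- by case.
- case=> [|[x0 y0] l] // s; case: ifP => // cyc ref sP x y.
  rewrite inE => /orP[/eqP[-> ->] px fx|]; last exact: IHe ref sP x y.
  exact: closes_cycle_sound sP _ _ _ px fx cyc.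
- case=> [|[x0 y0] l] // s; case: ifP => // pat ref sP x y.
  rewrite inE => /orP[/eqP[-> ->] px fx|]; last exact: IHe ref sP x y.
  exact: completes_pattern_sound sP fx pat.
- case=> [|[x0 y0] l] // s; case: ifP => // chld ref sP x y.
  rewrite inE => /orP[/eqP[-> ->] px fx|]; last exact: IHe ref sP x y.
  exact: IHc chld (extends_place sP fx).
Qed.

End Soundness.

Lemma has_add_pattern t r u v r' u' v' :
  has_pattern (add_pattern t r u v) r' u' v' ->
  has_pattern t r' u' v' \/ (r', u', v') = (r, u, v).
Proof.
rewrite /has_pattern /add_pattern vget_set; case: eqP => [<-|]; last by left.
rewrite vget_set; case: eqP => [<-|]; last by left.
by rewrite vget_set; case: eqP => [<-|]; [right | left].
Qed.

Lemma refutes_list_sound t ps cs : forbidden t -> refutes_list t ps cs ->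
  forall f, ~ bad f.
Proof.
elim: ps t cs => [|[[r u] v] ps IHps] t [|c cs] //= tP.
  case: cs => // ref f f_bad.
  have mul11 : 1 * 1 = 1 :> Z by rewrite mulr1.
  (* Subtracting [f 0] makes the map pass through (0,0). *)
  have g_bad := bad_renormalize 0 (f 0) mul11 f_bad.
  apply: (refutes_sound tP g_bad ref); apply: extends_place (extends_empty _) _.
  by rewrite /on /renormalize /= !mul1r addr0 subrr.
move=> /and3P[r_neq0 ref]; apply: IHps => r' u' v'.
move=> /has_add_pattern[/tP //|[-> -> ->]]; split; first by rewrite -res_eqE.
move=> f f_bad f0 f1 fu; apply: (refutes_sound tP f_bad ref).
by do 3 apply: extends_place => //; apply: extends_empty.
Qed.

(** * Cycle types of shifts *)

Section CycleType.

Variables (T : finType) (s : {perm T}).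

Lemma porbit_fixed x : s x = x -> porbit s x = [set x].
Proof.
move=> sx; apply/setP => y; rewrite inE; apply/idP/eqP => [/porbitP[i ->]|->].
  by elim: i => [|i IHi]; rewrite ?perm1 // expgSr permM IHi.
exact: porbit_id.
Qed.

Lemma iter_lt_porbit x k : (0 < k < #|porbit s x|)%N -> iter k s x <> x.
Proof.
move=> /andP[k_gt0 k_lt] kx; have := uniq_traject_porbit s x.
case: #|_| k_lt => // n; rewrite ltnS => le_kn.
rewrite trajectS /= => /andP[/negP xN _]; apply: xN.
apply/trajectP; exists k.-1.
  by rewrite prednK.
by rewrite -iterSr prednK.
Qed.

(** Two distinct fixed points and the orbit of any third point would give three orbits. *)
Lemma porbits_le2 : (2 < #|T|)%N -> (#|porbits s| <= 2)%N ->
  forall x y, s x = x -> s y = y -> x = y.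
Proof.
move=> T_gt2 le2 x y sx sy; apply/eqP; apply: contraTT le2 => neq_xy.
have [z] : exists z, z \notin [set x; y].
  apply/existsP; rewrite -negb_forall; apply: contraL T_gt2 => /forallP all_xy.
  rewrite -leqNgt -cardsT.
  have -> : [set: T] = [set x; y] by apply/setP => z; rewrite inE (all_xy z).
  by rewrite cards2; case: (_ != _).
rewrite !inE negb_or => /andP[zx zy]; rewrite -ltnNge.
have sub : [set porbit s x; porbit s y; porbit s z] \subset porbits s.
  by apply/subsetP => A; rewrite !inE -orbA => /or3P[] /eqP ->; apply: imset_f.
apply: leq_trans (subset_leq_card sub); rewrite -setUA cardsU1 cards2 !inE.
rewrite !(porbit_fixed sx, porbit_fixed sy) (inj_eq set1_inj) negb_or neq_xy /=.
have neq_z w : s w = w -> z != w -> [set w] != porbit s z.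
  move=> sw; apply: contraNneq => wz; have := porbit_id s z.
  by rewrite -wz inE.
by rewrite !neq_z.
Qed.

Lemma card_porbit_le2 z x : (#|porbits s| <= 2)%N -> s z = z -> s x != x ->
  #|porbit s x| = #|T|.-1.
Proof.
move=> le2 sz sx.
have neq_xz : x != z by apply: contraNneq sx => ->; rewrite sz.
rewrite -(cardsC1 z); apply: eq_card => y; rewrite !inE.
have neq_orb : porbit s z != porbit s x.
  rewrite (porbit_fixed sz); apply: contraNneq neq_xz => zx.
  by have := porbit_id s x; rewrite -zx inE.
have cover : porbits s = [set porbit s z; porbit s x].
  apply/esym/eqP; rewrite eqEcard cards2 neq_orb le2 andbT.
  by apply/subsetP => A; rewrite !inE => /orP[] /eqP ->; apply: imset_f.
have : porbit s y \in porbits s by apply: imset_f.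
rewrite cover !inE => /orP[] /eqP yO.
  have := porbit_id s y; rewrite yO (porbit_fixed sz) inE => /eqP ->.
  by rewrite eqxx -eq_porbit_mem (negPf neq_orb).
rewrite -eq_porbit_mem yO eqxx; apply/esym; apply: contraNneq neq_orb => <-.
by rewrite yO.
Qed.

(** The orbit size is a return time, so the orbit of [x] has at least [#|T|.-1] points; it misses
    [z], hence is everything else. *)
Lemma porbits_eq2 z x : s z = z ->
  (forall k, (0 < k < #|T|.-1)%N -> iter k s x != x) -> s x != x ->
  #|porbits s| = 2%N.
Proof.
move=> sz kx sx; have neq_xz : x != z by apply: contraNneq sx => ->; rewrite sz.
have neq_orb : porbit s z != porbit s x.
  rewrite (porbit_fixed sz); apply: contraNneq neq_xz => zx.
  by have := porbit_id s x; rewrite -zx inE.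
have zxN : z \notin porbit s x by rewrite -eq_porbit_mem.
have xO : porbit s x = [set~ z].
  apply/eqP; rewrite eqEcard cardsC1; apply/andP; split.
    by apply/subsetP => y yx; rewrite !inE; apply: contraNneq zxN => <-.
  rewrite leqNgt; apply/negP => lt_x.
  have /kx : (0 < #|porbit s x| < #|T|.-1)%N.
    by rewrite lt_x andbT card_gt0; apply/set0Pn; exists x; apply: porbit_id.
  by rewrite iter_porbit eqxx.
suff -> : porbits s = [set porbit s z; porbit s x] by rewrite cards2 neq_orb.
apply/setP => A; rewrite !inE; apply/imsetP/orP => [[y _ ->]|].
  have [->|neq_yz] := eqVneq y z; first by left.
  by right; rewrite eq_porbit_mem xO !inE.
by case=> /eqP ->; [exists z | exists x].
Qed.

End CycleType.

Lemma card_Z : #|Z| = 23%N. Proof. exact: card_ord. Qed.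

Lemma iter_shiftp (pi : {perm Z}) b k x :
  iter k (shiftp pi b) x + b = iter k (shift pi b) (x + b).
Proof. by elim: k => //= k <-; rewrite shiftp_val. Qed.

Lemma tclass_good (pi : {perm Z}) : tclass pi = 21%N -> good pi.
Proof.
move=> t21.
have le2 b : (#|porbits (shiftp pi b)| <= 2)%N.
  (* The minimum of [t] over the class is 21, so every shift has [t] at least 21. *)
  have := t21; rewrite /tclass; case: arg_minnP => // b0 _ /(_ b isT) min_b t0.
  rewrite leqNgt; apply/negP => /(leq_sub2l 23) le20; move: min_b.
  by rewrite t0 /Defs.tperm card_Z => /leq_trans/(_ le20).
have Z_gt2 : (2 < #|Z|)%N by rewrite card_Z.
have fix1 b := porbits_le2 Z_gt2 (le2 b).
have f_diff : injective (fun x => pi x - x).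
  (* Both [pi x] and [pi y] are fixed by the shift by [x - pi x]. *)
  move=> x y eq_xy; apply: (@perm_inj _ pi); apply: (fix1 (x - pi x)).
    by rewrite shiftp_val addrC subrK.
  by rewrite shiftp_val -[x - pi x]opprB eq_xy opprB addrC subrK.
have [d' _ d'K] := injF_bij f_diff.
split=> //; first exact: perm_inj.
move=> b x k k_bnd kx; apply/eqP; apply: contraTT isT => sx.
(* Surjectivity of [pi x - x] gives each shift a fixed point; the other 22 points then form one
   orbit, with no return before 22 steps. *)
have fixz : shiftp pi b (d' (- b) - b) = d' (- b) - b.
  rewrite shiftp_val subrK; apply: (addIr (- d' (- b))).
  by rewrite d'K addrAC subrr add0r.
have neq : shiftp pi b (x - b) != x - b.
  apply: contraNneq sx => e.
  by have := iter_shiftp pi b 1 (x - b); rewrite /= e subrK => <-.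
have := card_porbit_le2 (le2 b) fixz neq; rewrite card_Z /= => orb.
case: (@iter_lt_porbit _ (shiftp pi b) (x - b) k); first by rewrite orb.
by apply: (addIr b); rewrite iter_shiftp subrK.
Qed.

(** For a permutation of 23 points, one fixed point and one point not returning within 21 steps
    force cycle type 1 + 22. *)
Definition two_cycles (h : res -> res) : bool :=
  has (fun z => res_eq (h z) z) residues &&
  has (fun x => all (fun k => ~~ res_eq (iter k h x) x) (iota 1 21)) residues.

Lemma ab_pairs_two_cycles :
  all (fun ab => all (fun w =>
    two_cycles (fun x => res_add (res_abmap ab.1 ab.2 x) w)) residues) ab_pairs.
Proof. by vm_compute. Qed.

Lemma listed_tclass (pi : {perm Z}) : listed_fun pi -> tclass pi = 21%N.
Proof.
move=> /listed_funP[a [b [c [d [/ab_zpairsP[i [j [ijP -> ->]]] piE]]]]].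
(* Every shift attains 21, so it does not matter which one the minimum selects. *)
suff t21 e : Defs.tperm (shiftp pi e) = 21%N by apply: t21.
(* In the coordinate [y] with argument [y - (e + c)], the shift by [e] becomes [y |-> [a,b] y +
   w]. *)
have [w wE] := zvalP (d + (e + c)).
have := ab_pairs_two_cycles; move=> /allP/(_ _ ijP)/all_resP/(_ w).
set h := fun x => res_add (res_abmap i j x) w.
rewrite -/(two_cycles h) => /andP[/hasP[z _ hz] /hasP[x _ /allP hx]].
have sE y : shiftp pi e (zval y - (e + c)) = zval (h y) - (e + c).
  by rewrite shiftp_val piE -addrA subrK abmap_zval zvalD -wE addrA addrK.
have iterE k y :
    iter k (shiftp pi e) (zval y - (e + c)) = zval (iter k h y) - (e + c).
  by elim: k => //= k ->.
have neq k : (0 < k < 22)%N ->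
    iter k (shiftp pi e) (zval x - (e + c)) != zval x - (e + c).
  move=> k_bnd; rewrite iterE (inj_eq (addIr _)) (inj_eq zval_inj) -res_eqE.
  by apply: hx; rewrite mem_iota.
rewrite /Defs.tperm /cyc card_Z.
rewrite (@porbits_eq2 _ _ (zval z - (e + c)) (zval x - (e + c))) //.
- by rewrite sE; move: hz; rewrite res_eqE => /eqP ->.
- by rewrite card_Z.
- exact: (neq 1%N).
Qed.

(** * Good maps are exactly the listed ones, and the equivalence follows *)

Lemma good_listed f : good f -> listed_fun f.
Proof.
move=> f_good; apply: contraT => f_unlisted.
case: (refutes_list_sound _ certificates_refute (conj f_good f_unlisted)).
by move=> r u v; rewrite /has_pattern !vget_of.
Qed.

Theorem proposition2p7 (pi : {perm 'Z_23}) :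
  tclass pi = 21%N <->
  exists (a b c d : 'Z_23),
    [/\ a \is a GRing.unit, b \is a GRing.unit,
        (forall x : 'Z_23, pi x = abmap a b (x + c) + d) &
        ((a, b) \in [:: (5, 7); (7, 5); (10, 14); (14, 10);
                        (11, 15); (15, 11); (20, 21); (21, 20)]
         \/ (a = b /\ a \in [:: 5; 7; 10; 11; 14; 15; 17; 19; 20; 21]))].
Proof.
set pairs := [:: (5, 7); _; _; _; _; _; _; _].
set mults := [:: 5; _; _; _; _; _; _; _; _; _].
split=> [/tclass_good/good_listed/listed_funP[a [b [c [d [abP piE]]]]]|].
  have : all (fun ab => [&& ab.1 \is a GRing.unit, ab.2 \is a GRing.unit
      & (ab \in pairs) || (ab.1 == ab.2) && (ab.1 \in mults)]) ab_zpairs.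
    by vm_compute.
  move=> /allP/(_ _ abP)/and3P[a_unit b_unit abL]; exists a, b, c, d; split=> //.
  by case/orP: abL => [|/andP[/eqP]]; [left | right].
move=> [a [b [c [d [_ _ piE abL]]]]]; apply: listed_tclass; apply/listed_funP.
exists a, b, c, d; split=> //.
case: abL => [abL|[<- aL]].
  have : all [in ab_zpairs] pairs by vm_compute.
  by move=> /allP; apply.
have : all (fun a => (a, a) \in ab_zpairs) mults by vm_compute.
by move=> /allP; apply.
Qed.
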